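(* Let $n_1,n_2,n_3,m\in\mathbb{N}_0$, let $U\subseteq\mathbb{R}^{n_1+n_2}$ be open and non-empty, let $H\in\mathcal{C}^\infty(U)$, and let $J,R\in\mathbb{R}^{(n_1+n_2+n_3)\times(n_1+n_2+n_3)}$ and $B\in\mathbb{R}^{(n_1+n_2+n_3)\times m}$ satisfy $J+J^\top=0$, $R=R^\top$, $R\geq 0$. Then the dynamical system $$\begin{pmatrix}\partial_{z_1}H(z_1,z_2)\\ \tfrac{\mathrm{d}}{\mathrm{d}t}z_2\\ 0\end{pmatrix}=(J-R)\begin{pmatrix}\tfrac{\mathrm{d}}{\mathrm{d}t}z_1\\ \partial_{z_2}H(z_1,z_2)\\ z_3\end{pmatrix}+Bu,\qquad y=B^\top\begin{pmatrix}\tfrac{\mathrm{d}}{\mathrm{d}t}z_1\\ \partial_{z_2}H(z_1,z_2)\\ z_3\end{pmatrix}$$ in the variables $(z_1,z_2,z_3,u,y)$, with $(z_1,z_2)$ taking values in $U$, is equivalent to a port-Hamiltonian system with explicitly defined energy $H$.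
   Context: All vector spaces are real and finite-dimensional; trajectories are smooth functions on an open interval $(t_0,t_1)$. Here $z_i$ takes values in $\mathbb{R}^{n_i}$ and $u,y$ take values in $\mathbb{R}^m$; $\mathbb{R}^k$ and its dual are identified via coordinates. Dirac structure: a subspace $D\leq X\oplus X^*$ which is isotropic and co-isotropic (i.e. $D=D^\perp$) with respect to $\langle\!\langle (f,e),(f',e')\rangle\!\rangle:=\langle e,f'\rangle+\langle e',f\rangle$. Lagrangian subspace: a subspace $L\leq X\oplus X^*$ which is isotropic and co-isotropic with respect to $\Omega_{\mathrm{can}}((f,e),(f',e')):=\langle e,f'\rangle-\langle e',f\rangle$. It is non-negative if $\langle e,f\rangle\ge 0$ for all $(f,e)\in L$. Lagrangian submanifold in an open set $U'\subseteq X$: a smooth submanifold $\mathcal{L}\subseteq U'\times X^*$ each of whose tangent spaces is a Lagrangian subspace of $X\oplus X^*$. Port-Hamiltonian system: given spaces $X,X_r,X_p$, an open set $U'\subseteq X$, a Dirac structure $\mathcal{D}\leq(X\oplus X_r\oplus X_p)\oplus(X^*\oplus X_r^*\oplus X_p^* )$, a non-negative Lagrangian subspace $L_r\leq X_r\oplus X_r^*$ and a Lagrangian submanifold $\mathcal{L}\subseteq U'\times X^*$, it is the system $$\big(\tfrac{\mathrm{d}}{\mathrm{d}t}x,f_r,-y,e,e_r,u\big)\in\mathcal{D},\qquad (f_r,e_r)\in L_r,\qquad (x,e)\in\mathcal{L}$$ with state $x$ (in $U'$), covector $e$, resistive port variables $(f_r,e_r)$ and external port variables $(u,y)$. It has explicitly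 defined energy $K$ if $\mathcal{L}=\{(x,\partial_x K(x)) : x\in U'\}$ for the smooth function $K$ on $U'$; so ''explicitly defined energy $H$'' means $X=\mathbb{R}^{n_1+n_2}$, $U'=U$, $x=(z_1,z_2)$ and $\mathcal{L}=\{(z,\nabla H(z)) : z\in U\}$. Equivalence: a system is equivalent to a port-Hamiltonian system if its $u,y$ are the external port variables, its state variables $z_1,z_2$ are components of the state $x$, any further variables of the system (here $z_3$) are components of $e,f_r,e_r$ of the port-Hamiltonian system, and a trajectory solves the given system if and only if it can be completed by suitable remaining (latent) variables to a solution of the port-Hamiltonian system. *)

(* Defs.v *)
From HB Require Import structures.
From mathcomp Require Import all_boot all_order all_algebra.
From mathcomp Require Import all_classical all_reals all_analysis.
Set Implicit Arguments.
Unset Strict Implicit.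
Unset Printing Implicit Defensive.
Import Order.TTheory GRing.Theory Num.Theory.
Import numFieldNormedType.Exports.
Local Open Scope classical_set_scope.
Local Open Scope ring_scope.

Section Smoothness.
Context {K : realType}.

(* Functions on an open set A are represented by total functions, whose values
   outside A are irrelevant: for open A, differentiability at a point of A and
   the derivative there only depend on the restriction of f to A. *)
Fixpoint Ck (k : nat) (V W : normedModType K) (A : set V) (f : V -> W) : Prop :=
  if k is k'.+1 then
    (forall x, A x -> differentiable f x) /\ (forall v, Ck k' A ('D_v f))
  else forall x, A x -> {for x, continuous f}.

Definition smooth (V W : normedModType K) (A : set V) (f : V -> W) : Prop :=
  forall k, Ck k A f.

Definition gradient n (f : 'cV[K]_n -> K) (x : 'cV[K]_n) : 'cV[K]_n :=
  \col_i 'D_(delta_mx i 0) f x.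

Definition open_interval (t0 t1 : \bar K) : set K :=
  [set t | (t0 < t%:E)%E /\ (t%:E < t1)%E].

(* Embedded submanifold: around each of its points p, M is straightened to
   R^d x 0 by a diffeomorphism phi : W -> O between open sets (with inverse
   psi). *)
Definition smooth_submanifold (V : normedModType K) (M : set V) : Prop :=
  forall p, M p ->
  exists (d q : nat) (W : set V) (O : set ('cV[K]_d * 'cV[K]_q)%type)
    (phi : V -> ('cV[K]_d * 'cV[K]_q)%type)
    (psi : ('cV[K]_d * 'cV[K]_q)%type -> V),
  [/\ open W /\ W p, open O,
      smooth W phi /\ (forall x, W x -> O (phi x) /\ psi (phi x) = x),
      smooth O psi /\ (forall w, O w -> W (psi w) /\ phi (psi w) = w) &
      forall x, W x -> (M x <-> (phi x).2 = 0)].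

Definition tangent_space (V : normedModType K) (M : set V) (p : V) : set V :=
  [set v | exists (eps : K) (c : K -> V),
     [/\ 0 < eps,
         smooth (open_interval (- eps)%:E eps%:E) c,
         forall t, open_interval (- eps)%:E eps%:E t -> M (c t),
         c 0 = p &
         derive1 c 0 = v]].

End Smoothness.

(* X = R^n and its dual are both 'cV_n; elements of X (+) X^* are pairs (f, e)
   with flow f in X and effort e in X^*. *)
Section LinearStructures.
Context {K : realType}.

Definition pairing n (e f : 'cV[K]_n) : K := \sum_i e i 0 * f i 0.

Definition sym_form n (a b : 'cV[K]_n * 'cV[K]_n) : K :=
  pairing a.2 b.1 + pairing b.2 a.1.

Definition can_form n (a b : 'cV[K]_n * 'cV[K]_n) : K :=
  pairing a.2 b.1 - pairing b.2 a.1.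

Definition isotropic (V : vectType K) (form : V -> V -> K) (D : {vspace V}) :=
  forall a b, a \in D -> b \in D -> form a b = 0.

Definition coisotropic (V : vectType K) (form : V -> V -> K) (D : {vspace V}) :=
  forall a, (forall b, b \in D -> form a b = 0) -> a \in D.

Definition dirac_structure n (D : {vspace ('cV[K]_n * 'cV[K]_n)%type}) : Prop :=
  isotropic (@sym_form n) D /\ coisotropic (@sym_form n) D.

Definition lagrangian_subspace n
    (L : {vspace ('cV[K]_n * 'cV[K]_n)%type}) : Prop :=
  isotropic (@can_form n) L /\ coisotropic (@can_form n) L.

Definition nonneg_subspace n (L : {vspace ('cV[K]_n * 'cV[K]_n)%type}) : Prop :=
  forall f e, (f, e) \in L -> 0 <= pairing e f.

Definition lagrangian_submanifold n (U : set 'cV[K]_n)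
    (M : set ('cV[K]_n * 'cV[K]_n)%type) : Prop :=
  [/\ forall x e, M (x, e) -> U x,
      smooth_submanifold M &
      forall p, M p -> exists T : {vspace ('cV[K]_n * 'cV[K]_n)%type},
        lagrangian_subspace T /\ tangent_space M p = [set v | v \in T]].

End LinearStructures.

(* X = R^n, X_r = R^r, X_p = R^m; the direct sum X (+) X_r (+) X_p is
   'cV_(n + r + m). *)
Record ph_system (K : realType) (n r m : nat) := PhSystem {
  ph_dom : set 'cV[K]_n;
  ph_dirac : {vspace ('cV[K]_(n + r + m) * 'cV[K]_(n + r + m))%type};
  ph_res : {vspace ('cV[K]_r * 'cV[K]_r)%type};
  ph_lag : set ('cV[K]_n * 'cV[K]_n)%type;
  ph_dom_open : open ph_dom;
  ph_diracP : dirac_structure ph_dirac;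
  ph_resP : lagrangian_subspace ph_res;
  ph_res_nonneg : nonneg_subspace ph_res;
  ph_lagP : lagrangian_submanifold ph_dom ph_lag }.

Section Systems.
Context {K : realType}.

Definition ph_solution n r m (S : ph_system K n r m) (I : set K)
    (x : K -> 'cV[K]_n) (e : K -> 'cV[K]_n) (fr er : K -> 'cV[K]_r)
    (u y : K -> 'cV[K]_m) : Prop :=
  [/\ smooth I x /\ smooth I e,
      smooth I fr /\ smooth I er,
      smooth I u /\ smooth I y &
      forall t, I t ->
      [/\ ph_dom S (x t),
          (col_mx (col_mx (derive1 x t) (fr t)) (- y t),
           col_mx (col_mx (e t) (er t)) (u t)) \in ph_dirac S,
          (fr t, er t) \in ph_res S &
          ph_lag S (x t, e t)]].

Definition has_explicit_energy n r m (S : ph_system K n r m)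
    (E : 'cV[K]_n -> K) : Prop :=
  smooth (ph_dom S) E /\
  ph_lag S = [set (x, gradient E x) | x in ph_dom S].

(* A system, given by its set of solutions (z1, z2, z3, u, y) on each interval,
   whose state (z1, z2) is the full state x of S. The map c selects the
   components of (e, f_r, e_r) that make up z3; all other components are
   latent. *)
Definition equivalent_to_ph n1 n2 n3 r m
    (sol : set K -> (K -> 'cV[K]_n1) -> (K -> 'cV[K]_n2) -> (K -> 'cV[K]_n3) ->
           (K -> 'cV[K]_m) -> (K -> 'cV[K]_m) -> Prop)
    (S : ph_system K (n1 + n2) r m) : Prop :=
  exists2 c : 'I_n3 -> 'I_(n1 + n2 + r + r), injective c &
  forall (t0 t1 : \bar K), (t0 < t1)%E ->
  forall z1 z2 z3 u y,
    let I := open_interval t0 t1 in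
    sol I z1 z2 z3 u y <->
    exists e fr er,
      ph_solution S I (fun t => col_mx (z1 t) (z2 t)) e fr er u y /\
      (forall t, I t ->
         z3 t = \col_i (col_mx (col_mx (e t) (fr t)) (er t)) (c i) 0).

Definition dae_solution n1 n2 n3 m (U : set 'cV[K]_(n1 + n2))
    (H : 'cV[K]_(n1 + n2) -> K) (J R : 'M[K]_(n1 + n2 + n3))
    (B : 'M[K]_(n1 + n2 + n3, m)) (I : set K)
    (z1 : K -> 'cV[K]_n1) (z2 : K -> 'cV[K]_n2) (z3 : K -> 'cV[K]_n3)
    (u y : K -> 'cV[K]_m) : Prop :=
  [/\ [/\ smooth I z1, smooth I z2 & smooth I z3],
      smooth I u /\ smooth I y &
      forall t, I t ->
        let z := col_mx (z1 t) (z2 t) in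
        let d1H := usubmx (gradient H z) in
        let d2H := dsubmx (gradient H z) in
        let v := col_mx (col_mx (derive1 z1 t) d2H) (z3 t) in
        [/\ U z,
            col_mx (col_mx d1H (derive1 z2 t)) 0 = (J - R) *m v + B *m u t &
            y t = B^T *m v]].

End Systems.

(* Main.v *)
From HB Require Import structures.
Require Import Defs.
From mathcomp Require Import all_boot all_order all_algebra.
From mathcomp Require Import all_classical all_reals all_analysis.
From mathcomp Require Import ring.
Import Order.TTheory GRing.Theory Num.Theory.
Import numFieldNormedType.Exports.
Local Open Scope classical_set_scope.
Local Open Scope ring_scope.
Set Implicit Arguments.
Unset Strict Implicit.
Unset Printing Implicit Defensive.

(** Write [v = (z1', dH/dz2, z3)] for the vector multiplied by [J - R] and
    [w = (dH/dz1, z2', 0)] for the left-hand side.  The dissipation is moved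
    into a resistive port of dimension [n1 + n2 + n3]: put [f_r = v] and
    [e_r = R v].  Then [(f_r, e_r)] lies on the graph of [R], which is
    Lagrangian because [R] is symmetric and non-negative because [R >= 0]
    ([lagrangian_graph_space], [nonneg_graph_space]), and the remaining
    equations are linear in the flows [(z1', z2', f_r, -y)] and efforts
    [(dH/dz1, dH/dz2, e_r, u)]: the first two blocks of [f_r = v], and
    [w = J f_r - e_r + B u], [-y = - B^T f_r].  They define a Dirac structure
    ([dirac_dae]): the power balance vanishes because [J] is skew-symmetric, and
    pairing with sufficiently many elements gives all the constraints back.
    The third block of [f_r = v] is no constraint but the definition of [z3],
    so the algebraic third row of the system stays among the equations and need
    not be solved for anything.

    It remains to see that the graph of the gradient of [H] is a Lagrangian
    submanifold ([lagrangian_gradient]).  The shear [(x, e) |-> (x, e - G x)]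
    straightens the graph of a smooth map [G], and the tangent space of this
    graph is the graph of the Jacobian of [G] ([tangent_space_graph_set]).  For
    [G] the gradient of [H] the Jacobian is the Hessian, symmetric by the
    theorem of Schwarz ([derive_comm]), so its graph is Lagrangian for the same
    reason as the graph of [R].

    Smoothness of the latent trajectories needs closure of [Ck] under sums,
    products and composition; the composition rule [Ck_comp] is proved in
    coordinates, where the derivative of a composite is a finite sum of
    products of functions of one degree of smoothness less. *)

(** * Calculus of [Ck] functions *)

Section Calculus.
Context {K : realType}.
Implicit Types V W : normedModType K.

(** The difference of two functions that agree near a point has derivative
    zero there, so differentiability is a local notion. *)
Lemma near_eq_differentiable V W (f g : V -> W) (x : V) :
  (\near x, f x = g x) -> differentiable f x -> differentiable g x.
Proof.
move=> fg df; have -> : g = f + (g - f) by rewrite addrC subrK.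
apply: (differentiableD df); set h := g - f.
have h0 : \near x, h x = 0.
  by near=> y; rewrite /h !fctE -(near fg y) ?subrr.
have ho : h \o shift x = cst (h x) + ((\0 : {linear V -> W}) : V -> W) +o_ 0 id.
  rewrite (nbhs_singleton h0); apply/eqaddoP => e e0.
  move: h0; rewrite (near_shift 0) subr0 => h0.
  near=> y.
  have hy : h (y + x) = 0 by near: y; exact: h0.
  rewrite [X in `|X|](_ : _ = h (y + x) - (0 + 0)) // hy addr0 subr0.
  by rewrite normr0 mulr_ge0 // ltW.
have c0 : continuous ((\0 : {linear V -> W}) : V -> W) by exact: cst_continuous.
by apply/diff_locallyP; rewrite (diff_unique c0 ho).
Unshelve. all: by end_near. Qed.

(** On an open set the derivatives only see the values on the set; this lets
    every induction below replace ['D_v f] by the formula for it that holds on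
    [A] alone. *)
Lemma Ck_ext k V W (A : set V) (f g : V -> W) :
  open A -> (forall x, A x -> f x = g x) -> Ck k A f -> Ck k A g.
Proof.
move=> oA; elim: k f g => [|k IH] f g fg /=.
  move=> cf x Ax; have cfx : f @ x --> f x := cf x Ax.
  suff : g @ x --> g x by [].
  rewrite -(fg x Ax); apply: (cvg_trans _ cfx); apply: near_eq_cvg.
  by apply: filterS (open_nbhs_nbhs (conj oA Ax)) => y /fg.
have nfg x : A x -> \near x, f x = g x.
  by move=> Ax; apply: filterS (open_nbhs_nbhs (conj oA Ax)) => y /fg.
move=> [df Df]; split=> [x Ax|v].
  exact: near_eq_differentiable (nfg x Ax) (df x Ax).
by apply: IH (Df v) => x Ax; exact/near_eq_derive/nfg.
Qed.

Lemma CkW k V W (A : set V) (f : V -> W) : Ck k.+1 A f -> Ck k A f.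
Proof.
elim: k f => [|k IH] f [df Df] /=.
  by move=> x Ax; exact/differentiable_continuous/df.
by split=> // v; apply: IH; exact: Df.
Qed.

Lemma Ck_differentiable k V W (A : set V) (f : V -> W) x :
  Ck k.+1 A f -> A x -> differentiable f x.
Proof. by move=> [df _]; exact: df. Qed.

Lemma Ck_cst k V W (A : set V) (a : W) : Ck k A (cst a).
Proof.
elim: k a => [|k IH] a /=; first by move=> x _; exact: cst_continuous.
split=> [x _|v]; first exact: differentiable_cst.
have -> : 'D_v (cst a : V -> W) = cst 0 by apply/funext => x; exact: derive_cst.
exact: IH.
Qed.

Lemma Ck_id k V (A : set V) : Ck k A (@id V).
Proof.
case: k => [|k] /=; first by move=> x _.
split=> [x _|v]; first exact: ex_diff.
have -> : 'D_v (@id V) = cst v by apply/funext => x; exact: derive_id.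
exact: Ck_cst.
Qed.

Lemma CkD k V W (A : set V) (f g : V -> W) : open A ->
  Ck k A f -> Ck k A g -> Ck k A (fun x => f x + g x).
Proof.
move=> oA; elim: k f g => [|k IH] f g /=.
  by move=> cf cg x Ax; apply: continuousD; [exact: cf|exact: cg].
move=> [df Df] [dg Dg]; split=> [x Ax|v].
  by apply: differentiableD; [exact: df|exact: dg].
apply: (Ck_ext oA _ (IH _ _ (Df v) (Dg v))) => x Ax /=.
by rewrite deriveD //; apply: diff_derivable; [exact: df|exact: dg].
Qed.

Lemma Ck_sum k V W (A : set V) n (f : 'I_n -> V -> W) : open A ->
  (forall i, Ck k A (f i)) -> Ck k A (fun x => \sum_i f i x).
Proof.
move=> oA; elim: n f => [|n IH] f cf.
  rewrite (_ : (fun x => _) = cst 0); first exact: Ck_cst.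
  by apply/funext => x; rewrite big_ord0.
rewrite (_ : (fun x => _) = fun x => f ord0 x + \sum_i f (lift ord0 i) x).
  exact: CkD oA (cf _) (IH _ (fun i => cf _)).
by apply/funext => x; rewrite big_ord_recl.
Qed.

Lemma derive_linear V W W' (f : V -> W) (L : {linear W -> W'}) (x v : V) :
  continuous L -> differentiable f x -> 'D_v (L \o f) x = L ('D_v f x).
Proof.
move=> cL df; have dL : differentiable L (f x) by exact: linear_differentiable.
rewrite (deriveE v df) (deriveE v (differentiable_comp df dL)).
by have -> := diff_comp df dL; have /= -> := diff_lin (f x) cL.
Qed.

Lemma Ck_linear k V W W' (A : set V) (f : V -> W) (L : {linear W -> W'}) :
  open A -> continuous L -> Ck k A f -> Ck k A (L \o f).
Proof.
move=> oA cL; elim: k f => [|k IH] f /=.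
  move=> cf x Ax; apply: continuous_comp; [exact: cf|].
  exact: (cL (f x)).
move=> [df Df]; have dL y : differentiable L y by exact: linear_differentiable.
split=> [x Ax|v]; first by apply: differentiable_comp => //; exact: df.
apply: (Ck_ext oA _ (IH _ (Df v))) => x Ax /=.
by rewrite (derive_linear v cL (df x Ax)).
Qed.

Lemma CkN k V W (A : set V) (f : V -> W) : open A ->
  Ck k A f -> Ck k A (fun x => - f x).
Proof.
move=> oA cf; have cN : continuous (-%R : {linear W -> W}) by exact: opp_continuous.
exact: (Ck_linear oA cN cf).
Qed.

Lemma Ck_fst k V W (A : set (V * W)%type) : open A ->
  Ck k A (fst : V * W -> V).
Proof.
move=> oA; have cf : continuous (fst : V * W -> V) by move=> p; exact: cvg_fst.
exact: (Ck_linear oA cf (Ck_id k A)).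
Qed.

Lemma Ck_snd k V W (A : set (V * W)%type) : open A ->
  Ck k A (snd : V * W -> W).
Proof.
move=> oA; have cf : continuous (snd : V * W -> W) by move=> p; exact: cvg_snd.
exact: (Ck_linear oA cf (Ck_id k A)).
Qed.

Lemma Ck_pair k V W W' (A : set V) (f : V -> W) (g : V -> W') : open A ->
  Ck k A f -> Ck k A g -> Ck k A (fun x => (f x, g x)).
Proof.
move=> oA; elim: k f g => [|k IH] f g /=.
  move=> cf cg x Ax; have cfx : f @ x --> f x := cf x Ax.
  have cgx : g @ x --> g x := cg x Ax.
  suff : (fun y => (f y, g y)) @ x --> (f x, g x) by [].
  exact: cvg_pair.
move=> [df Df] [dg Dg]; split=> [x Ax|v].
  by apply: differentiable_pair; [exact: df|exact: dg].
apply: (Ck_ext oA _ (IH _ _ (Df v) (Dg v))) => x Ax /=.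
have [dfx dgx] := (df x Ax, dg x Ax).
rewrite (deriveE v (differentiable_pair dfx dgx)) (deriveE v dfx) (deriveE v dgx).
by have -> := diff_pair dfx dgx.
Qed.

Lemma CkM k V (A : set V) (f g : V -> K) : open A ->
  Ck k A f -> Ck k A g -> Ck k A (fun x => f x * g x).
Proof.
move=> oA; elim: k f g => [|k IH] f g.
  by move=> cf cg x Ax; apply: continuousM; [exact: cf|exact: cg].
move=> cf cg; have [[df Df] [dg Dg]] := (cf, cg); split=> [x Ax|v].
  by apply: differentiableM; [exact: df|exact: dg].
apply: (Ck_ext oA _ (CkD oA (IH _ _ (CkW cf) (Dg v)) (IH _ _ (CkW cg) (Df v)))).
move=> x Ax /=.
by rewrite deriveM //; apply: diff_derivable; [exact: df|exact: dg].
Qed.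

Lemma Ck_scalel k V W (A : set V) (f : V -> K) (w : W) : open A ->
  Ck k A f -> Ck k A (fun x => f x *: w).
Proof.
move=> oA cf; have lin : linear ( *:%R ^~ w : K -> W).
  by move=> u y z; rewrite scalerDl scalerA.
pose LM := GRing.isLinear.Build _ _ _ _ _ lin.
pose L : {linear _ -> _} := HB.pack ( *:%R ^~ w : K -> W) LM.
have cL : continuous L by exact: scalel_continuous.
exact: (Ck_linear oA cL cf).
Qed.

(** Both directions are instances of [Ck_linear]: the coordinates are continuous
    linear forms, and a vector is the sum of its coordinates times the basis
    vectors. *)
Lemma Ck_coord k V (A : set V) n (f : V -> 'cV[K]_n) : open A ->
  Ck k A f <-> forall i, Ck k A (fun x => f x i 0).
Proof.
move=> oA; split=> [cf i|cf].
  have @L : {linear 'cV[K]_n -> K}.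
    by exists (fun N : 'cV[K]_n => N i 0); do 2![eexists]; do ?[constructor];
     rewrite ?mxE// => ? *; rewrite ?mxE//; move=> ?; rewrite !mxE.
  have cL : continuous L by exact: coord_continuous.
  exact: (Ck_linear oA cL cf).
have -> : f = fun x => \sum_i (f x i 0 *: (delta_mx i 0 : 'cV[K]_n)).
  apply/funext => x; rewrite {1}[f x]matrix_sum_delta; apply: eq_bigr => i _.
  by rewrite big_ord1.
apply: Ck_sum => // i; exact: Ck_scalel (cf i).
Qed.

Lemma derive_gradient n (g : 'cV[K]_n -> K) (y w : 'cV[K]_n) :
  differentiable g y -> 'D_w g y = pairing (gradient g y) w.
Proof.
move=> dg; rewrite deriveE // {1}[w]matrix_sum_delta linear_sum.
apply: eq_bigr => i _; rewrite big_ord1 linearZ /= mxE deriveE //.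
by rewrite mulrC.
Qed.

Lemma derive_comp_gradient V n (f : V -> 'cV[K]_n) (g : 'cV[K]_n -> K) (x v : V) :
  differentiable f x -> differentiable g (f x) ->
  'D_v (g \o f) x = pairing (gradient g (f x)) ('D_v f x).
Proof.
move=> df dg; rewrite -derive_gradient // (deriveE v (differentiable_comp df dg)).
by have -> := diff_comp df dg; rewrite (deriveE _ dg) (deriveE v df).
Qed.

Lemma derive_coord V n (f : V -> 'cV[K]_n) (x v : V) i : differentiable f x ->
  'D_v f x i 0 = 'D_v (fun y => f y i 0) x.
Proof. by move=> df; rewrite derive_mx ?mxE //; exact: diff_derivable. Qed.

(** By induction on [k]: the chain rule writes ['D_v (g \o f)] as the sum over
    [i] of ['D_(delta_mx i 0) g \o f], of class [Ck k] by the induction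
    hypothesis, times the [i]-th coordinate of ['D_v f].  Expanding in
    coordinates keeps the induction within real-valued [g], with no need for
    derivatives that take values in spaces of linear maps. *)
Lemma Ck_comp k V n (A : set V) (B : set 'cV[K]_n) (f : V -> 'cV[K]_n)
    (g : 'cV[K]_n -> K) : open A -> (forall x, A x -> B (f x)) ->
  Ck k A f -> Ck k B g -> Ck k A (g \o f).
Proof.
move=> oA AB; elim: k g => [|k IH] g.
  move=> cf cg x Ax; apply: continuous_comp; [exact: cf|].
  exact: (cg _ (AB _ Ax)).
move=> cf [dg Dg]; have [df Df] := cf.
split=> [x Ax|v].
  by apply: differentiable_comp; [exact: df|exact/dg/AB].
have cD : Ck k A (fun x => \sum_i ('D_(delta_mx i 0) g \o f) x * 'D_v f x i 0).
  apply: Ck_sum => // i; apply: CkM => //; first exact/IH/Dg/CkW.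
  by have /(Ck_coord _ _ oA) := Df v; exact.
apply: (Ck_ext oA _ cD) => x Ax /=.
rewrite derive_comp_gradient; [|exact: df|exact/dg/AB].
by apply: eq_bigr => i _; rewrite mxE.
Qed.

Lemma Ck_compv k V n m (A : set V) (B : set 'cV[K]_n) (f : V -> 'cV[K]_n)
    (g : 'cV[K]_n -> 'cV[K]_m) :
  open A -> open B -> (forall x, A x -> B (f x)) ->
  Ck k A f -> Ck k B g -> Ck k A (g \o f).
Proof.
move=> oA oB AB cf /(Ck_coord _ _ oB) cg; apply/(Ck_coord _ _ oA) => i.
exact: (Ck_comp oA AB cf (cg i)).
Qed.

Definition jacobian_cv n m (G : 'cV[K]_n -> 'cV[K]_m) (x : 'cV[K]_n) : 'M[K]_(m, n) :=
  \matrix_(i, j) 'D_(delta_mx j 0) (fun y => G y i 0) x.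

Lemma derive_comp_jacobian V n m (f : V -> 'cV[K]_n) (G : 'cV[K]_n -> 'cV[K]_m)
    (x v : V) : differentiable f x -> differentiable G (f x) ->
  'D_v (G \o f) x = jacobian_cv G (f x) *m 'D_v f x.
Proof.
move=> df dG; have dGf := differentiable_comp df dG.
apply/colP => i; rewrite (derive_coord v i dGf) mxE.
have dGi : differentiable (fun y => G y i 0) (f x).
  exact: (@differentiable_comp _ _ _ _ G (fun N : 'cV[K]_m => N i 0) (f x) dG
    (differentiable_coord _ _ _)).
rewrite -[LHS]/('D_v ((fun y => G y i 0) \o f) x) (derive_comp_gradient v df dGi).
by apply: eq_bigr => j _; rewrite !mxE.
Qed.

Lemma open_open_interval (a b : \bar K) : open (open_interval a b).
Proof. by apply: openI; [exact: open_ereal_gt|exact: open_ereal_lt]. Qed.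

Lemma smooth_gradient n (U : set 'cV[K]_n) (H : 'cV[K]_n -> K) :
  open U -> smooth U H -> smooth U (gradient H).
Proof.
move=> oU sH k; apply/(Ck_coord _ _ oU) => i; have [_ DH] := sH k.+1.
rewrite (_ : (fun x => _) = 'D_(delta_mx i 0) H); first exact: DH.
by apply/funext => x; rewrite mxE.
Qed.

Lemma smooth_derive1 n (A : set K) (f : K -> 'cV[K]_n) :
  smooth A f -> smooth A (derive1 f).
Proof.
move=> sf k; rewrite (_ : derive1 f = 'D_1 f); first by have [_] := sf k.+1; exact.
by apply/funext => t; exact: derive1E.
Qed.

Lemma Ck_col_mx k V (A : set V) n m (f : V -> 'cV[K]_n) (g : V -> 'cV[K]_m) :
  open A -> Ck k A f -> Ck k A g -> Ck k A (fun t => col_mx (f t) (g t)).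
Proof.
move=> oA /(Ck_coord _ _ oA) cf /(Ck_coord _ _ oA) cg.
apply/(Ck_coord _ _ oA) => i; case: (split_ordP i) => j ->.
  rewrite (_ : (fun x => _) = (fun x => f x j 0)); first exact: cf.
  by apply/funext => x; rewrite col_mxEu.
rewrite (_ : (fun x => _) = (fun x => g x j 0)); first exact: cg.
by apply/funext => x; rewrite col_mxEd.
Qed.

Lemma Ck_usubmx k V (A : set V) n m (f : V -> 'cV[K]_(n + m)) : open A ->
  Ck k A f -> Ck k A (fun t => usubmx (f t)).
Proof.
move=> oA /(Ck_coord _ _ oA) cf; apply/(Ck_coord _ _ oA) => i.
rewrite (_ : (fun x => _) = (fun x => f x (lshift m i) 0)); first exact: cf.
by apply/funext => x; rewrite mxE.
Qed.

Lemma Ck_dsubmx k V (A : set V) n m (f : V -> 'cV[K]_(n + m)) : open A ->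
  Ck k A f -> Ck k A (fun t => dsubmx (f t)).
Proof.
move=> oA /(Ck_coord _ _ oA) cf; apply/(Ck_coord _ _ oA) => i.
rewrite (_ : (fun x => _) = (fun x => f x (rshift n i) 0)); first exact: cf.
by apply/funext => x; rewrite mxE.
Qed.

Lemma Ck_mulmx k V (A : set V) n m (M : 'M[K]_(m, n)) (f : V -> 'cV[K]_n) :
  open A -> Ck k A f -> Ck k A (fun t => M *m f t).
Proof.
move=> oA /(Ck_coord _ _ oA) cf; apply/(Ck_coord _ _ oA) => i.
rewrite (_ : (fun x => _) = (fun x => \sum_j M i j * f x j 0)).
  by apply: Ck_sum => // j; apply: CkM => //; exact: Ck_cst.
by apply/funext => x; rewrite mxE.
Qed.

Lemma derive_col_mx V n m (f : V -> 'cV[K]_n) (g : V -> 'cV[K]_m) (x v : V) :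
  differentiable f x -> differentiable g x ->
  differentiable (fun y => col_mx (f y) (g y)) x ->
  'D_v (fun y => col_mx (f y) (g y)) x = col_mx ('D_v f x) ('D_v g x).
Proof.
move=> df dg dfg; apply/colP => i; rewrite (derive_coord v i dfg).
case: (split_ordP i) => j ->; rewrite ?col_mxEu ?col_mxEd derive_coord //.
  by congr ('D_v _ x); apply/funext => y; rewrite col_mxEu.
by congr ('D_v _ x); apply/funext => y; rewrite col_mxEd.
Qed.

End Calculus.

(** * Symmetry of second derivatives *)

Section Schwarz.
Context {K : realType} {V : normedModType K}.
Implicit Types (f : V -> K) (x p v w : V).

Lemma is_derive_line f p v (s : K) : differentiable f (p + s *: v) ->
  is_derive s 1 (fun t => f (p + t *: v)) ('D_v f (p + s *: v)).
Proof.
move=> df.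
have dl : is_diff s (fun t : K => p + t *: v) (fun t => t *: v).
  have dp : is_diff s (cst p : K -> V) 0 by exact: is_diff_cst.
  have dv : is_diff s ( *:%R ^~ v : K -> V) ( *:%R ^~ v) by exact: is_diff_scalel.
  by have := is_diffD dp dv; rewrite add0r; exact.
have dfl : is_diff s (f \o (fun t : K => p + t *: v))
    ('d f (p + s *: v) \o (fun t => t *: v)).
  by apply: is_diff_comp; exact: differentiableP.
apply: DeriveDef; first by apply: diff_derivable; exact: ex_diff.
rewrite (deriveE _ (ex_diff (is_diff_def := dfl))) diff_val /= scale1r.
by rewrite deriveE.
Qed.

Lemma MVT_line f p v (h : K) : 0 < h ->
  (forall s : K, 0 <= s <= h -> differentiable f (p + s *: v)) ->
  exists2 s : K, 0 <= s <= h & f (p + h *: v) - f p = h * 'D_v f (p + s *: v).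
Proof.
move=> h0 df.
have [||s] := @MVT _ (fun t => f (p + t *: v)) (fun t => 'D_v f (p + t *: v)) 0 h h0.
- move=> s; rewrite in_itv /= => /andP[s0 sh].
  by apply/is_derive_line/df; rewrite !ltW.
- apply: derivable_within_continuous => s; rewrite in_itv /= => sh.
  by have [] := is_derive_line (df s sh).
rewrite in_itv /= => /andP[s0 sh] E; exists s; first by rewrite !ltW.
by move: E; rewrite scale0r addr0 subr0 mulrC.
Qed.

(** The mean value theorem applied twice: first in direction [v] to the increment
    of [f] over [h *: w], then in direction [w] to ['D_v f]. *)
Lemma second_difference f x v w (h : K) : 0 < h ->
  (forall s t : K, 0 <= s <= h -> 0 <= t <= h ->
     differentiable f (x + s *: v + t *: w) /\
     differentiable ('D_v f) (x + s *: v + t *: w)) ->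
  exists s t : K, [/\ 0 <= s <= h, 0 <= t <= h &
    f (x + h *: v + h *: w) - f (x + h *: v) - (f (x + h *: w) - f x)
      = h * (h * 'D_w ('D_v f) (x + s *: v + t *: w))].
Proof.
move=> h0 df.
have h0h : 0 <= h <= h by rewrite lexx ltW.
have z0h : 0 <= (0 : K) <= h by rewrite lexx ltW.
pose g p := f (p + h *: w) - f p.
have dg (s : K) : 0 <= s <= h -> is_diff (x + s *: v) g
    (('d f (x + s *: v + h *: w) : V -> K) - ('d f (x + s *: v) : V -> K)).
  move=> sh; have [d1 _] := df s h sh h0h; have [d2 _] := df s 0 sh z0h.
  rewrite scale0r addr0 in d2.
  apply: is_diffB; last exact: differentiableP.
  have dsh : is_diff (x + s *: v) (fun p => p + h *: w) id.
    have di : is_diff (x + s *: v) (@id V) id by exact: is_diff_id.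
    have dc : is_diff (x + s *: v) (cst (h *: w) : V -> V) 0 by exact: is_diff_cst.
    by have := is_diffD di dc; rewrite addr0; exact.
  have := @is_diff_comp _ _ _ _ (fun p => p + h *: w) id f _ _ dsh (differentiableP d1).
  exact.
have [|s sh Es] := @MVT_line g x v h h0.
  by move=> s sh; have [] := dg s sh.
have [|t th Et] := @MVT_line ('D_v f) (x + s *: v) w h h0.
  by move=> t th; have [] := df s t sh th.
exists s, t; split=> //.
rewrite -Et; have -> : f (x + h *: v + h *: w) - f (x + h *: v)
    - (f (x + h *: w) - f x) = g (x + h *: v) - g x by [].
rewrite Es; congr (_ * _).
have [d1 _] := df s h sh h0h; have [d2 _] := df s 0 sh z0h.
rewrite scale0r addr0 in d2.
have dgs := dg s sh.
by rewrite (deriveE v (ex_diff (is_diff_def := dgs))) diff_val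
  (deriveE v d1) (deriveE v d2).
Qed.

(** Schwarz: the second difference of [f] over a small parallelogram with sides
    [h *: v] and [h *: w] is symmetric in [v] and [w].  By [second_difference] it is
    [h ^+ 2] times a value of either mixed derivative at points close to [x],
    and both mixed derivatives are continuous at [x]. *)
Lemma derive_comm (A : set V) f x v w : open A -> A x -> Ck 2 A f ->
  'D_v ('D_w f) x = 'D_w ('D_v f) x.
Proof.
move=> oA Ax [df Df].
(* Abstract names for the two mixed derivatives, so that they are never unfolded
   and compared with each other. *)
have [a Ea] : exists a, a = 'D_v ('D_w f) := ex_intro _ _ erefl.
have [b Eb] : exists b, b = 'D_w ('D_v f) := ex_intro _ _ erefl.
have ca : a @ x --> a x by rewrite Ea; have [_ /(_ v) ca] := Df w; exact: ca.
have cb : b @ x --> b x by rewrite Eb; have [_ /(_ w) cb] := Df v; exact: cb.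
suff : a x = b x by rewrite Ea Eb; apply.
apply/eqP; rewrite -subr_eq0 -normr_le0; apply/ler_addgt0Pl => e e0; rewrite addr0.
have e20 : 0 < e / 2 by rewrite divr_gt0.
have near_ab : \forall y \near x, [/\ A y, `|a x - a y| < e / 2 & `|b x - b y| < e / 2].
  have nA : \forall y \near x, A y by exact: open_nbhs_nbhs.
  have na : \forall y \near x, `|a x - a y| < e / 2.
    exact: ((cvgrPdist_lt _ _).1 ca _ e20).
  have nb : \forall y \near x, `|b x - b y| < e / 2.
    exact: ((cvgrPdist_lt _ _).1 cb _ e20).
  by apply: filterS3 nA na nb => y; split.
have [d d0 xd] := (nbhs_ballP _ _).1 near_ab.
(* This step size keeps the parallelogram inside the ball of radius [d]. *)
pose h := d / (`|v| + `|w| + 1).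
have N0 : 0 < `|v| + `|w| + 1 by rewrite ltr_wpDl // addr_ge0.
have h0 : 0 < h by rewrite divr_gt0.
have inb (s t : K) : 0 <= s <= h -> 0 <= t <= h -> ball x d (x + s *: v + t *: w).
  move=> /andP[s0 sh] /andP[t0 th]; rewrite -ball_normE /= distrC.
  rewrite -(addrA x) [x + _]addrC addrK.
  apply: (le_lt_trans (ler_normD _ _)); rewrite !normrZ !ger0_norm //.
  apply: (@le_lt_trans _ _ (h * (`|v| + `|w|))).
    by rewrite mulrDr lerD // ler_wpM2r.
  have -> : d = h * (`|v| + `|w| + 1) by rewrite /h divfK ?gt_eqF.
  by rewrite ltr_pM2l // ltrDl.
have [s1 [t1 [s1h t1h E1]]] : exists s t : K, [/\ 0 <= s <= h, 0 <= t <= h &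
    f (x + h *: v + h *: w) - f (x + h *: v) - (f (x + h *: w) - f x)
      = h * (h * b (x + s *: v + t *: w))].
  rewrite Eb; apply: second_difference => // s t sh th.
  have [Ay _ _] := xd _ (inb s t sh th).
  by split; [exact: df|have [dD _] := Df v; exact: dD].
have [t2 [s2 [t2h s2h E2]]] : exists s t : K, [/\ 0 <= s <= h, 0 <= t <= h &
    f (x + h *: w + h *: v) - f (x + h *: w) - (f (x + h *: v) - f x)
      = h * (h * a (x + s *: w + t *: v))].
  rewrite Ea; apply: second_difference => // t s th sh; rewrite addrAC.
  have [Ay _ _] := xd _ (inb s t sh th).
  by split; [exact: df|have [dD _] := Df w; exact: dD].
have [_ _ db] := xd _ (inb _ _ s1h t1h).
have [_ da _] := xd _ (inb _ _ s2h t2h).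
have Eab : a (x + s2 *: v + t2 *: w) = b (x + s1 *: v + t1 *: w).
  have hn : h != 0 by rewrite gt_eqF.
  apply: (mulfI hn); apply: (mulfI hn); rewrite -E1 [x + s2 *: v + _]addrAC -E2.
  by rewrite [x + h *: w + _]addrAC; ring.
move: da; rewrite Eab => da.
rewrite -(subrK (b (x + s1 *: v + t1 *: w)) (a x)) -addrA (splitr e).
apply: (le_trans (ler_normD _ _)); apply: lerD; first exact: ltW.
by rewrite distrC ltW.
Qed.

End Schwarz.

(** * The duality pairing *)

Section Pairing.
Context {K : realType}.

Lemma pairingC n (a b : 'cV[K]_n) : pairing a b = pairing b a.
Proof. by apply: eq_bigr => i _; rewrite mulrC. Qed.

Lemma pairingDl n (a b c : 'cV[K]_n) :
  pairing (a + b) c = pairing a c + pairing b c.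
Proof. by rewrite -big_split; apply: eq_bigr => i _; rewrite mxE mulrDl. Qed.

Lemma pairingDr n (a b c : 'cV[K]_n) :
  pairing a (b + c) = pairing a b + pairing a c.
Proof. by rewrite pairingC pairingDl !(pairingC a). Qed.

Lemma pairingNl n (a b : 'cV[K]_n) : pairing (- a) b = - pairing a b.
Proof. by rewrite -sumrN; apply: eq_bigr => i _; rewrite mxE mulNr. Qed.

Lemma pairingNr n (a b : 'cV[K]_n) : pairing a (- b) = - pairing a b.
Proof. by rewrite pairingC pairingNl pairingC. Qed.

Lemma pairing0l n (a : 'cV[K]_n) : pairing 0 a = 0.
Proof. by apply: big1 => i _; rewrite mxE mul0r. Qed.

Lemma pairing0r n (a : 'cV[K]_n) : pairing a 0 = 0.
Proof. by rewrite pairingC pairing0l. Qed.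

Lemma pairing_mulmx n m (A : 'M[K]_(m, n)) (a : 'cV[K]_n) (b : 'cV[K]_m) :
  pairing (A *m a) b = pairing a (A^T *m b).
Proof.
transitivity (((A *m a)^T *m b) 0 0).
  by rewrite [RHS]mxE; apply: eq_bigr => i _; rewrite [in RHS]mxE.
by rewrite trmx_mul -mulmxA mxE; apply: eq_bigr => i _; rewrite [in LHS]mxE.
Qed.

Lemma pairing_skew n (A : 'M[K]_n) (a b : 'cV[K]_n) :
  A + A^T = 0 -> pairing (A *m a) b = - pairing (A *m b) a.
Proof.
move=> /eqP; rewrite addrC addr_eq0 => /eqP A_skew.
by rewrite pairing_mulmx A_skew mulNmx pairingNr pairingC.
Qed.

Lemma pairing_col_mx n m (a c : 'cV[K]_n) (b d : 'cV[K]_m) :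
  pairing (col_mx a b) (col_mx c d) = pairing a c + pairing b d.
Proof.
rewrite /pairing big_split_ord; congr (_ + _); apply: eq_bigr => i _.
  by rewrite !col_mxEu.
by rewrite !col_mxEd.
Qed.

Lemma pairing_nondegenerate n (a : 'cV[K]_n) :
  (forall w, pairing a w = 0) -> a = 0.
Proof.
move=> aw; apply/colP => i; rewrite mxE -(aw (delta_mx i 0)) /pairing.
rewrite (bigD1 i) //= big1 ?mxE ?eqxx ?mulr1 ?addr0 // => j ji.
by rewrite mxE (negbTE ji) mulr0.
Qed.

Lemma mem_lker_linfun (V W : vectType K) (F : V -> W) (v : V) :
  linear F -> (v \in lker (linfun F)) = (F v == 0).
Proof.
move=> linF; pose FM := GRing.isLinear.Build _ _ _ _ _ linF.
pose L : {linear V -> W} := HB.pack F FM.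
by rewrite memv_ker -[linfun F]/(linfun L) lfunE.
Qed.

End Pairing.

(** * Graphs as Lagrangian subspaces and submanifolds *)

Section Graphs.
Context {K : realType}.

Definition graph_space n (A : 'M[K]_n) : {vspace ('cV[K]_n * 'cV[K]_n)%type} :=
  lker (linfun (fun a : 'cV[K]_n * 'cV[K]_n => a.2 - A *m a.1)).

Lemma mem_graph_space n (A : 'M[K]_n) f e :
  (f, e) \in graph_space A <-> e = A *m f.
Proof.
rewrite mem_lker_linfun => [|k a b /=].
  by split=> [/eqP/subr0_eq|->] //=; rewrite subrr.
by rewrite mulmxDr -scalemxAr scalerBr opprD addrACA.
Qed.

(** Symmetry gives isotropy; testing against all [(w, A *m w)] shows that an
    element orthogonal to the graph satisfies its equation. *)
Lemma lagrangian_graph_space n (A : 'M[K]_n) :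
  A^T = A -> lagrangian_subspace (graph_space A).
Proof.
move=> As; split=> [[f e] [f' e'] /mem_graph_space -> /mem_graph_space ->|[f e] orth].
  by rewrite /can_form /= pairing_mulmx As pairingC subrr.
apply/mem_graph_space/subr0_eq/pairing_nondegenerate => w.
have /orth : (w, A *m w) \in graph_space A by apply/mem_graph_space.
by rewrite /can_form /= (pairing_mulmx A w) As (pairingC w) pairingDl pairingNl.
Qed.

Definition graph_set n (U : set 'cV[K]_n) (G : 'cV[K]_n -> 'cV[K]_n) :
  set ('cV[K]_n * 'cV[K]_n)%type := [set (x, G x) | x in U].

(** The shear [(x, e) |-> (x, e - G x)] of [U] times the dual space maps the
    graph onto the zero section; its inverse adds [G x] back. *)
Lemma submanifold_graph_set n (U : set 'cV[K]_n) (G : 'cV[K]_n -> 'cV[K]_n) :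
  open U -> smooth U G -> smooth_submanifold (graph_set U G).
Proof.
move=> oU sG _ [x Ux <-].
pose W := [set p : 'cV[K]_n * 'cV[K]_n | U p.1].
have oW : open W by apply: open_comp => // p _; exact: cvg_fst.
have sG1 k : Ck k W (fun p => G p.1).
  by apply: (Ck_compv oW oU _ (Ck_fst k oW) (sG k)).
exists n, n, W, W, (fun p => (p.1, p.2 - G p.1)), (fun p => (p.1, p.2 + G p.1)).
split=> //.
- split=> [k|[a b] Wa /=]; last by rewrite subrK.
  apply: Ck_pair => //; first exact: Ck_fst.
  by apply: CkD => //; [exact: Ck_snd|exact: CkN].
- split=> [k|[a b] Wa /=]; last by rewrite addrK.
  apply: Ck_pair => //; first exact: Ck_fst.
  by apply: CkD => //; exact: Ck_snd.
- move=> [a b] /= Wa; split=> [[c Uc [<- <-]]|/subr0_eq ->]; first by rewrite subrr.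
  by exists a.
Qed.

(** A curve in the graph has the form [t |-> (l t, G (l t))], whose velocity lies
    in the graph of the Jacobian by the chain rule; conversely the vector
    [(a, jacobian_cv G x *m a)] is the velocity at [0] of the curve over the
    segment [x + t *: a]. *)
Lemma tangent_space_graph_set n (U : set 'cV[K]_n) (G : 'cV[K]_n -> 'cV[K]_n) x :
  open U -> smooth U G -> U x ->
  tangent_space (graph_set U G) (x, G x) = [set v | v \in graph_space (jacobian_cv G x)].
Proof.
move=> oU sG Ux.
have cfst : continuous (fst : 'cV[K]_n * 'cV[K]_n -> 'cV[K]_n).
  by move=> p; exact: cvg_fst.
have csnd : continuous (snd : 'cV[K]_n * 'cV[K]_n -> 'cV[K]_n).
  by move=> p; exact: cvg_snd.
have dG y : U y -> differentiable G y by exact: (Ck_differentiable (sG 1)).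
apply/seteqP; split=> [_ [eps [c [eps0 sc cM c0 <-]]]|[a b]] /=.
  set I := open_interval (- eps)%:E eps%:E in sc cM.
  have oI : open I by exact: open_open_interval.
  have I0 : I 0 by rewrite /I /open_interval /= !lte_fin oppr_lt0 eps0.
  have dc : differentiable c 0 := Ck_differentiable (sc 1) I0.
  rewrite derive1E [X in X \in _]surjective_pairing; apply/mem_graph_space.
  rewrite -(derive_linear _ cfst dc) -(derive_linear _ csnd dc).
  have dfc : differentiable (fst \o c) 0.
    exact: differentiable_comp dc (linear_differentiable _ cfst).
  have cU t : I t -> U (c t).1 by move=> /cM [y Uy <-].
  have -> : jacobian_cv G x = jacobian_cv G ((fst \o c) 0) by rewrite /= c0.
  rewrite -(derive_comp_jacobian _ dfc (dG _ (cU _ I0))).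
  apply: near_eq_derive; apply: filterS (open_nbhs_nbhs (conj oI I0)) => t.
  by move=> /cM [y Uy] /= <-.
move=> /mem_graph_space ->.
pose l (t : K) := x + t *: a.
have cl : continuous l.
  move=> t; apply: cvgD; first exact: cvg_cst.
  exact: scalel_continuous.
have [eps eps0 epsU] : exists2 eps : K, 0 < eps & forall t, `|t| < eps -> U (l t).
  have : nbhs (0 : K) (l @^-1` U).
    by apply: (cl 0); rewrite /l scale0r addr0; exact: open_nbhs_nbhs.
  move=> /nbhs_ballP[eps eps0 epsU]; exists eps => // t te; apply: epsU.
  by rewrite -ball_normE /= sub0r normrN.
set I := open_interval (- eps)%:E eps%:E.
have oI : open I by exact: open_open_interval.
have I0 : I 0 by rewrite /I /open_interval /= !lte_fin oppr_lt0 eps0.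
have IU t : I t -> U (l t).
  by rewrite /I /open_interval /= !lte_fin => /andP te; apply: epsU; rewrite ltr_norml.
have sl k : Ck k I l.
  apply: CkD => //; first exact: Ck_cst.
  by apply: Ck_scalel => //; exact: Ck_id.
have sGl k : Ck k I (G \o l) by exact: (Ck_compv oI oU IU (sl k) (sG k)).
have sc k : Ck k I (fun t => (l t, (G \o l) t)) by exact: Ck_pair.
have dc := Ck_differentiable (sc 1) I0.
exists eps, (fun t => (l t, (G \o l) t)); split=> //.
- by move=> t It; exists (l t); first exact: IU.
- by rewrite /l /= scale0r addr0.
rewrite derive1E [LHS]surjective_pairing.
rewrite -(derive_linear _ cfst dc) -(derive_linear _ csnd dc).
rewrite -[snd \o _]/(G \o l) -[fst \o _]/l.
have dl := Ck_differentiable (sl 1) I0.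
rewrite (derive_comp_jacobian _ dl (dG _ (IU _ I0))).
have -> : 'D_1 l 0 = a.
  have dp : is_diff (0 : K) (cst x : K -> 'cV[K]_n) 0 by exact: is_diff_cst.
  have da : is_diff (0 : K) ( *:%R ^~ a : K -> 'cV[K]_n) ( *:%R ^~ a).
    exact: is_diff_scalel.
  have [dl' El] := is_diffD dp da.
  by rewrite (deriveE _ dl') El !fctE add0r scale1r.
by rewrite /l scale0r addr0.
Qed.

(** The Jacobian of the gradient is the Hessian, symmetric by [derive_comm]. *)
Lemma lagrangian_gradient n (U : set 'cV[K]_n) (H : 'cV[K]_n -> K) :
  open U -> smooth U H -> lagrangian_submanifold U (graph_set U (gradient H)).
Proof.
move=> oU sH; have sG := smooth_gradient oU sH.
split=> [x e [y Uy [<- _]] //||_ [x Ux <-]]; first exact: submanifold_graph_set.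
exists (graph_space (jacobian_cv (gradient H) x)).
split; last exact: tangent_space_graph_set.
apply: lagrangian_graph_space; apply/matrixP => i j; rewrite !mxE.
have E k : (fun y => gradient H y k 0) = 'D_(delta_mx k 0) H.
  by apply/funext => y; rewrite mxE.
by rewrite !E; exact: (derive_comm _ _ oU Ux (sH 2)).
Qed.

End Graphs.

(** * The Dirac structure of the system *)

Lemma linear_col_mx (K : realType) p q (k : K) (a c : 'cV[K]_p) (b d : 'cV[K]_q) :
  col_mx (k *: a + c) (k *: b + d) = k *: col_mx a b + col_mx c d.
Proof. by rewrite scale_col_mx add_col_mx. Qed.

Section DaeDirac.
Context {K : realType} (n1 n2 n3 m : nat).
Let N := (n1 + n2 + n3)%N.
Let X := 'cV[K]_(n1 + n2 + N + m).
Variables (J : 'M[K]_N) (B : 'M[K]_(N, m)).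

(** The defects of [f_r = (v_1, v_2, _)], [w = J f_r - e_r + B u] and
    [f_p = - B^T f_r] for the flow [a.1 = (f_x, f_r, f_p)] and the effort
    [a.2 = (e_x, e_r, u)], where [(v_1, v_2)] consists of the first block of [f_x]
    and the second one of [e_x], and [w] of the other two blocks and [0]. *)
Definition dae_constraints (a : X * X) : 'cV[K]_(n1 + n2) * 'cV[K]_N * 'cV[K]_m :=
  let fx := usubmx (usubmx a.1) in let fr := dsubmx (usubmx a.1) in
  let ex := usubmx (usubmx a.2) in let er := dsubmx (usubmx a.2) in
  (usubmx fr - col_mx (usubmx fx) (dsubmx ex),
   col_mx (col_mx (usubmx ex) (dsubmx fx)) 0 - (J *m fr - er + B *m dsubmx a.2),
   dsubmx a.1 + B^T *m fr).

Lemma dae_constraints_linear : linear dae_constraints.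
Proof.
move=> k a b; rewrite /dae_constraints /=.
have z : (0 : 'cV[K]_n3) = k *: 0 + 0 by rewrite scaler0 addr0.
rewrite !linearP /= {1}z !linear_col_mx.
have tripleP (x x' : 'cV[K]_(n1 + n2)) (y y' : 'cV[K]_N) (w w' : 'cV[K]_m) :
  k *: (x, y, w) + (x', y', w') = (k *: x + x', k *: y + y', k *: w + w') by [].
rewrite tripleP; apply: (congr2 pair); [apply: (congr2 pair)|].
- by rewrite scalerBr opprD addrACA.
- rewrite [X in _ - (X + _)]addrACA -scalerDr [X in _ - X]addrACA -scalerDr.
  by rewrite scalerBr opprD addrACA.
- by rewrite scalerDr addrACA.
Qed.

Definition dae_dirac : {vspace (X * X)%type} := lker (linfun dae_constraints).

Lemma port_blocks (a : X) : exists (a1 : 'cV[K]_n1) (a2 : 'cV[K]_n2)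
  (ar : 'cV[K]_N) (ap : 'cV[K]_m), a = col_mx (col_mx (col_mx a1 a2) ar) ap.
Proof.
exists (usubmx (usubmx (usubmx a))), (dsubmx (usubmx (usubmx a))).
by exists (dsubmx (usubmx a)), (dsubmx a); rewrite !vsubmxK.
Qed.

Lemma mem_dae_dirac f1 f2 fr fp e1 e2 er ep :
  (col_mx (col_mx (col_mx f1 f2) fr) fp, col_mx (col_mx (col_mx e1 e2) er) ep)
    \in dae_dirac <->
  [/\ usubmx fr = col_mx f1 e2,
      er = J *m fr + B *m ep - col_mx (col_mx e1 f2) 0 &
      fp = - (B^T *m fr)].
Proof.
rewrite mem_lker_linfun; last exact: dae_constraints_linear.
rewrite /dae_constraints /= !(col_mxKu, col_mxKd).
split=> [/eqP[/subr0_eq -> /subr0_eq -> /eqP]|[-> -> ->]].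
  by rewrite addr_eq0 => /eqP ->; split=> //; rewrite [J *m _ - _ + _]addrAC subKr.
rewrite subrr addNr; apply/eqP; congr (_, _, _).
by rewrite [J *m _ - _ + _]addrAC subKr subrr.
Qed.

(** Isotropy is the power balance: the resistive and external terms cancel the
    storage terms up to [J], which is skew-symmetric.  For co-isotropy, the form
    evaluated on the parametrized elements of the structure is the sum of the
    pairings of the free parameters with the defects of the constraints, so
    each defect vanishes. *)
Lemma dirac_dae : J + J^T = 0 -> dirac_structure dae_dirac.
Proof.
move=> J_skew; split=> [[f e] [f' e']|[f e] orth].
  have [f1 [f2 [fr [fp ->]]]] := port_blocks f.
  have [e1 [e2 [er [ep ->]]]] := port_blocks e.
  have [f1' [f2' [fr' [fp' ->]]]] := port_blocks f'.
  have [e1' [e2' [er' [ep' ->]]]] := port_blocks e'.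
  move=> /mem_dae_dirac[Er -> ->] /mem_dae_dirac[Er' -> ->].
  rewrite /sym_form /= !pairing_col_mx !pairingDl !pairingNl !pairingNr.
  have E a b : pairing (col_mx (col_mx a b) 0) fr = pairing a f1 + pairing b e2.
    by rewrite -[fr]vsubmxK Er !pairing_col_mx pairing0l addr0.
  have E' a b : pairing (col_mx (col_mx a b) 0) fr' = pairing a f1' + pairing b e2'.
    by rewrite -[fr']vsubmxK Er' !pairing_col_mx pairing0l addr0.
  rewrite E E' (pairing_skew fr fr' J_skew) (pairingC f2) (pairingC f2').
  rewrite (pairing_mulmx B ep) (pairing_mulmx B ep'); ring.
move: orth; have [f1 [f2 [fr [fp ->]]]] := port_blocks f.
have [e1 [e2 [er [ep ->]]]] := port_blocks e => orth.
(* The element of the Dirac structure with resistive flow [phi], input [mu] and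
   [s1], [s2] for the first effort block and the second flow block; these four
   can be chosen freely. *)
have test s1 s2 (phi : 'cV[K]_N) (mu : 'cV[K]_m) :
    pairing (col_mx (col_mx e1 f2) 0 + er - (J *m fr + B *m ep)) phi
    + (pairing s1 (f1 - usubmx (usubmx fr)) + pairing s2 (e2 - dsubmx (usubmx fr)))
    + pairing mu (B^T *m fr + fp) = 0.
  pose p1 := usubmx (usubmx phi); pose p2 := dsubmx (usubmx phi).
  have := orth (col_mx (col_mx (col_mx p1 s2) phi) (- (B^T *m phi)),
    col_mx (col_mx (col_mx s1 p2) (J *m phi + B *m mu - col_mx (col_mx s1 s2) 0)) mu).
  have D : (col_mx (col_mx (col_mx p1 s2) phi) (- (B^T *m phi)),
    col_mx (col_mx (col_mx s1 p2) (J *m phi + B *m mu - col_mx (col_mx s1 s2) 0)) mu)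
      \in dae_dirac by apply/mem_dae_dirac; split=> //; rewrite vsubmxK.
  move=> /(_ D) <-; rewrite /sym_form /= !pairing_col_mx !pairingDl !pairingNl.
  have E a b (c : 'cV[K]_N) : pairing (col_mx (col_mx a b) 0) c
      = pairing a (usubmx (usubmx c)) + pairing b (dsubmx (usubmx c)).
    by rewrite -{1}[c]vsubmxK -{1}[usubmx c]vsubmxK !pairing_col_mx pairing0l addr0.
  rewrite !E -/p1 -/p2 !pairingDl !pairingDr !pairingNr (pairing_skew fr phi J_skew).
  rewrite (pairing_mulmx B ep) (pairing_mulmx B mu) (pairingC f2) (pairingC e2 s2); ring.
have Z1 : f1 = usubmx (usubmx fr).
  apply/subr0_eq/pairing_nondegenerate => w.
  by have := test w 0 0 0; rewrite !pairing0l pairing0r !addr0 add0r pairingC.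
have Z2 : e2 = dsubmx (usubmx fr).
  apply/subr0_eq/pairing_nondegenerate => w.
  by have := test 0 w 0 0; rewrite !pairing0l pairing0r !addr0 !add0r pairingC.
have Z3 : fp = - (B^T *m fr).
  apply/eqP; rewrite -addr_eq0 addrC; apply/eqP/pairing_nondegenerate => w.
  by have := test 0 0 0 w; rewrite !pairing0l pairing0r !add0r pairingC.
apply/mem_dae_dirac; split=> //; first by rewrite Z1 Z2 vsubmxK.
apply/eqP; rewrite eq_sym subr_eq eq_sym addrC -subr_eq0.
apply/eqP/pairing_nondegenerate => w.
by have := test 0 0 w 0; rewrite !pairing0l !addr0.
Qed.

End DaeDirac.

(** * The port-Hamiltonian system *)

Section Main.
Context {K : realType} (n1 n2 n3 m : nat).
Let N := (n1 + n2 + n3)%N.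
Variables (U : set 'cV[K]_(n1 + n2)) (H : 'cV[K]_(n1 + n2) -> K)
  (J R : 'M[K]_(n1 + n2 + n3)) (B : 'M[K]_(n1 + n2 + n3, m)).
Hypotheses (U_open : open U) (H_smooth : smooth U H)
  (J_skew : J + J^T = 0) (R_sym : R = R^T)
  (R_ge0 : forall v : 'cV[K]_(n1 + n2 + n3), 0 <= (v^T *m R *m v) 0 0).

Lemma nonneg_graph_space : nonneg_subspace (graph_space R).
Proof.
move=> f e /mem_graph_space ->; have := R_ge0 f.
rewrite -mulmxA mxE; congr (0 <= _).
by apply: eq_bigr => i _; rewrite [in LHS]mxE mulrC.
Qed.

Definition dae_ph : ph_system K (n1 + n2) N m :=
  PhSystem U_open (dirac_dae B J_skew) (lagrangian_graph_space (esym R_sym))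
    nonneg_graph_space (lagrangian_gradient U_open H_smooth).

Definition z3_index (i : 'I_n3) : 'I_(n1 + n2 + N + N) :=
  lshift N (rshift (n1 + n2) (rshift (n1 + n2) i)).

Lemma z3_index_inj : injective z3_index.
Proof. by move=> i j /lshift_inj /rshift_inj /rshift_inj. Qed.

Lemma z3_indexE (e : 'cV[K]_(n1 + n2)) (fr er : 'cV[K]_N) :
  \col_i (col_mx (col_mx e fr) er) (z3_index i) 0 = dsubmx fr.
Proof. by apply/colP => i; rewrite mxE [RHS]mxE col_mxEu col_mxEd. Qed.

(** The latent variables are forced: [e] is the gradient of [H] along the state,
    [f_r = v] and [e_r = R f_r].  Substituting [e_r] into the Dirac structure turns
    [J f_r - e_r] into [(J - R) v]. *)
Lemma equivalent_dae_ph : equivalent_to_ph (dae_solution U H J R B) dae_ph.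
Proof.
exists z3_index; first exact: z3_index_inj.
move=> t0 t1 t01 z1 z2 z3 u y I.
have oI : open I by exact: open_open_interval.
have I_z t : smooth I z1 -> smooth I z2 -> I t ->
   derive1 (fun t => col_mx (z1 t) (z2 t)) t = col_mx (derive1 z1 t) (derive1 z2 t).
  move=> s1 s2 It; rewrite !derive1E derive_col_mx //.
  - exact: (Ck_differentiable (s1 1)).
  - exact: (Ck_differentiable (s2 1)).
  - exact: (Ck_differentiable (Ck_col_mx oI (s1 1) (s2 1))).
split=> [[[s1 s2 s3] [su sy] sol]|[e [fr [er [[[sx se] [sfr ser] [su sy] sol] z3E]]]]].
  pose x t := col_mx (z1 t) (z2 t).
  pose e t := gradient H (x t).
  pose fr t := col_mx (col_mx (derive1 z1 t) (dsubmx (e t))) (z3 t).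
  have sx : smooth I x by move=> k; exact: Ck_col_mx.
  have xU t : I t -> U (x t) by move=> /sol[].
  have se : smooth I e.
    by move=> k; apply: (Ck_compv oI U_open xU (sx k)); exact: smooth_gradient.
  have sfr : smooth I fr.
    move=> k; apply: Ck_col_mx => //; apply: Ck_col_mx => //.
      exact: smooth_derive1.
    exact: Ck_dsubmx.
  exists e, fr, (fun t => R *m fr t); split; last first.
    by move=> t It; rewrite z3_indexE col_mxKd.
  split=> //; first by split=> // k; exact: Ck_mulmx.
  move=> t It; have [Uz eqz eqy] := sol t It; split=> //.
  - rewrite I_z // -[e t]vsubmxK; apply/mem_dae_dirac; split.
    + by rewrite col_mxKu.
    + by rewrite eqz mulmxBl [J *m _ - _ + _]addrAC subKr.
    + by rewrite eqy.
  - exact/mem_graph_space.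
  - by exists (x t).
have s1 : smooth I z1.
  move=> k; have := Ck_usubmx oI (sx k).
  by apply: Ck_ext => // t _; rewrite col_mxKu.
have s2 : smooth I z2.
  move=> k; have := Ck_dsubmx oI (sx k).
  by apply: Ck_ext => // t _; rewrite col_mxKd.
have s3 : smooth I z3.
  move=> k; have := Ck_dsubmx oI (sfr k).
  by apply: Ck_ext => // t It; rewrite z3E // z3_indexE.
split=> // t It; have [Uz D /mem_graph_space Er [x _ [Ex Ee]]] := sol t It.
rewrite Ex in Ee; move: D.
rewrite I_z // -[e t]vsubmxK => /mem_dae_dirac[Efr Eer Ey].
have Ev : fr t = col_mx (col_mx (derive1 z1 t) (dsubmx (e t))) (z3 t).
  by rewrite z3E // z3_indexE -Efr vsubmxK.
rewrite /= Ee -Ev; split=> //; last exact: oppr_inj.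
by rewrite mulmxBl -Er Eer addrAC subKr.
Qed.

End Main.

Theorem proposition4p3 (K : realType) (n1 n2 n3 m : nat)
  (U : set 'cV[K]_(n1 + n2)) (H : 'cV[K]_(n1 + n2) -> K)
  (J R : 'M[K]_(n1 + n2 + n3)) (B : 'M[K]_(n1 + n2 + n3, m))
  (U_open : open U) (U_neq0 : U !=set0) (H_smooth : smooth U H)
  (J_skew : J + J^T = 0) (R_sym : R = R^T)
  (R_ge0 : forall v : 'cV[K]_(n1 + n2 + n3), 0 <= (v^T *m R *m v) 0 0) :
  exists (r : nat) (S : ph_system K (n1 + n2) r m),
    [/\ ph_dom S = U,
        has_explicit_energy S H &
        equivalent_to_ph (dae_solution U H J R B) S].
Proof.
exists (n1 + n2 + n3)%N, (dae_ph B U_open H_smooth J_skew R_sym R_ge0).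
by split=> //; exact: equivalent_dae_ph.
Qed.
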